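(* Let $n \in \mathbb{N}$, $n \geq 2$, be arbitrary and let $\mathcal{POP}_{n}$ be the monoid of orientation-preserving partial transformations on $\{1,\ldots,n\}$ with the usual order. Then the maximal subsemigroups of $\mathcal{POP}_{n}$ are precisely: (a) $(\mathcal{POP}_{n} \setminus \mathcal{C}_{n}) \cup L$, where $L$ is a maximal subgroup of the cyclic group $\mathcal{C}_{n}$ (type (M5)); (b) $\mathcal{POP}_{n} \setminus \{\alpha \in \mathcal{OP}_{n} : \operatorname{rank}(\alpha) = n - 1\}$ (type (M4)); and (c) $\mathcal{POP}_{n} \setminus \{\alpha \in \mathcal{POPI}_{n} : \operatorname{rank}(\alpha) = n - 1\}$ (type (M4)). The monoid $\mathcal{POP}_{1} = \mathcal{PT}_{1}$ is a semilattice of order $2$: its maximal subsemigroups are each of its singleton subsets. In particular, for $n \in \mathbb{N}$, there are $|\mathbb{P}_{n}| + 2$ maximal subsemigroups of $\mathcal{POP}_{n}$, where $\mathbb{P}_{n}$ is the set of primes that divide $n$.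
   Context: $\mathbb{N}=\{1,2,3,\ldots\}$. A maximal subsemigroup of a semigroup $S$ (maximal subgroup of a group) is a proper subsemigroup (subgroup) not contained in any other proper one. A semilattice is a commutative semigroup of idempotents. $\mathcal{PT}_n$ is the monoid of all partial maps from $\{1,\ldots,n\}$ to itself (partial transformations) under composition, maps written on the right. A transformation is an element with domain $\{1,\ldots,n\}$; a partial permutation is an injective element. $\operatorname{rank}(\alpha)=|\operatorname{im}(\alpha)|$. If $\operatorname{dom}(\alpha)=\{i_1<\cdots<i_k\}$, put $i_{k+1}=i_1$; $\alpha$ is orientation-preserving if there is at most one $l\in\{1,\ldots,k\}$ with $i_l\alpha>i_{l+1}\alpha$. $\mathcal{OP}_n$ is the set of transformations in $\mathcal{POP}_n$, and $\mathcal{POPI}_n$ is the set of partial permutations in $\mathcal{POP}_n$. $\mathcal{C}_n$ is the cyclic group generated by the permutation $(1\ 2\ \ldots\ n)$; it is the group of units of $\mathcal{POP}_n$. Types: a maximal subsemigroup $M$ of a finite monoid $S$ arises from the $\mathscr{J}$-class $J$ if $S\setminus M\subseteq J$; when $J$ is regular, $M$ has type (M4) if $M\cap J$ is a non-empty union of $\mathscr{R}$-classes of $J$, and type (M5) if $M\cap J$ meets every $\mathscr{H}$-class of $J$. *)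

(* Defs.v *)
From HB Require Import structures.
From mathcomp Require Import all_boot all_fingroup gseries.

Set Implicit Arguments.
Unset Strict Implicit.
Unset Printing Implicit Defensive.

Local Open Scope group_scope.

(** * Maximal subsemigroups and Green's relations

   The finite monoid is the type [S] with the product [mul].  In a monoid the
   principal ideals of [a] are [aS], [Sa] and [SaS]. *)

Section FiniteMonoid.
Variables (S : finType) (mul : S -> S -> S).
Implicit Types (a b x y : S) (M J X : {set S}).

Local Notation "a * b" := (mul a b).

Definition subsemigroup M : bool :=
  (M != set0) && [forall a in M, forall b in M, a * b \in M].

Definition maximal_subsemigroup M : bool :=
  maxset (fun N : {set S} => subsemigroup N && (N \proper [set: S])) M.

Definition right_ideal a : {set S} := [set a * x | x : S].
Definition left_ideal a : {set S} := [set x * a | x : S].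
Definition two_sided_ideal a : {set S} := [set x * a * y | x : S, y : S].

Definition green_R a b : bool := right_ideal a == right_ideal b.
Definition green_L a b : bool := left_ideal a == left_ideal b.
Definition green_H a b : bool := green_R a b && green_L a b.
Definition green_J a b : bool := two_sided_ideal a == two_sided_ideal b.

Definition R_class a : {set S} := [set b | green_R a b].
Definition H_class a : {set S} := [set b | green_H a b].
Definition J_class a : {set S} := [set b | green_J a b].

Definition regular J : Prop := forall a, a \in J -> exists x, a * x * a = a.

Definition arises_from M J : Prop :=
  [/\ maximal_subsemigroup M, exists a, J = J_class a & ~: M \subset J].

Definition type_M4 M : Prop :=
  exists J, [/\ arises_from M J, regular J &
    exists X, [/\ X != set0, X \subset J & M :&: J = \bigcup_(a in X) R_class a]].

Definition type_M5 M : Prop :=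
  exists J, [/\ arises_from M J, regular J &
    forall a, a \in J -> M :&: J :&: H_class a != set0].

Definition semilattice : Prop :=
  (forall a b, a * b = b * a) /\ (forall a, a * a = a).

End FiniteMonoid.

(** * Partial transformations

   The points 1, ..., n are represented by the ordinals 0, ..., n-1 with their
   usual order, and [a i = None] means that [i] is not in the domain of [a].
   Maps act on the right: [a * b] is [a] followed by [b], as for ['S_n]. *)

Definition PT (n : nat) := {ffun 'I_n -> option 'I_n}.
HB.instance Definition _ n := Finite.on (PT n).

Section PartialTransformations.
Variable n : nat.
Implicit Types a b c : PT n.

Definition PT_mul a b : PT n := [ffun i => obind b (a i)].
Definition PT_one : PT n := [ffun i => Some i].

Lemma PT_mulA : associative PT_mul.
Proof. by move=> a b c; apply/ffunP=> i; rewrite !ffunE; case: (a i) => //= j; rewrite ffunE. Qed.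

Lemma PT_mul1 : left_id PT_one PT_mul.
Proof. by move=> a; apply/ffunP=> i; rewrite !ffunE. Qed.

Lemma PT_mulr1 : right_id PT_one PT_mul.
Proof. by move=> a; apply/ffunP=> i; rewrite !ffunE; case: (a i) => //= j; rewrite ffunE. Qed.

HB.instance Definition _ := isMonoid.Build (PT n) PT_mulA PT_mul1 PT_mulr1.

Definition dom a : {set 'I_n} := [set i | a i != None].
Definition im a : {set 'I_n} := [set j | [exists i, a i == Some j]].
Definition rank a : nat := #|im a|.

Definition transformation a : bool := dom a == [set: 'I_n].

Definition partial_permutation a : bool :=
  [forall i in dom a, forall j in dom a, (a i == a j) ==> (i == j)].

(* If dom a = {i_1 < ... < i_k}, then [images a] is i_1 a, ..., i_k a. *)
Definition images a : seq 'I_n := pmap a (enum 'I_n).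

(* The pairs in [zip s (rot 1 s)] are the (s_l, s_(l+1)), where s_(k+1) = s_1. *)
Definition cyclic_descents (s : seq 'I_n) : nat :=
  count (fun p : 'I_n * 'I_n => p.2 < p.1) (zip s (rot 1 s)).

Definition orientation_preserving a : bool := cyclic_descents (images a) <= 1.

End PartialTransformations.

Section Closure.
Variable n : nat.
Implicit Types (a b : PT n) (s t : seq 'I_n).

Local Notation leO := (fun x y : 'I_n => x <= y).

Let leO_trans : transitive leO.
Proof. by move=> y x z; apply: leq_trans. Qed.

Definition descents x s : nat :=
  count (fun p : 'I_n * 'I_n => p.2 < p.1) (zip (belast x s) s).

Lemma cyclic_descentsE x s :
  cyclic_descents (x :: s) = (descents x s + (x < last x s))%N.
Proof.
rewrite /cyclic_descents /descents rot1_cons lastI -cats1 -[rcons s x]cats1.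
by rewrite zip_cat ?size_belast // count_cat /= addn0.
Qed.

Lemma descents0 x s : (descents x s == 0) = path leO x s.
Proof.
rewrite /descents; elim: s x => //= y s IH x.
by rewrite addn_eq0 IH eqb0 -leqNgt.
Qed.

Lemma cyclic_descents_cat s t : cyclic_descents (s ++ t) = cyclic_descents (t ++ s).
Proof.
have E (u : seq 'I_n) k : cyclic_descents (rot k u) = cyclic_descents u.
  have rotz (v w : seq 'I_n) : size v = size w ->
      zip (rot k v) (rot k w) = rot k (zip v w).
    move=> vw; rewrite /rot zip_cat ?size_drop ?vw //.
    congr (_ ++ _); first by elim: k v w vw => [|k IH] [|? ?] [|? ?] //= [] /IH.
    by elim: k v w vw => [|k IH] [|? ?] [|? ?] //= [] /IH ->.
  rewrite /cyclic_descents rot_rot rotz ?size_rot //.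
  by rewrite (seq.permP (permEl (perm_rot _ _))).
by rewrite -(E (s ++ t) (size s)) rot_size_cat.
Qed.

Lemma sorted_cyclic_descents s : sorted leO s -> cyclic_descents s <= 1.
Proof.
case: s => // x s /=; rewrite -descents0 => /eqP H.
by rewrite cyclic_descentsE H add0n leq_b1.
Qed.

Lemma cyclic_descents_split s : cyclic_descents s <= 1 ->
  exists s1 s2, s = s1 ++ s2 /\ sorted leO (s2 ++ s1).
Proof.
case: (boolP (sorted leO s)) => [sS _|]; first by exists [::], s; rewrite cats0.
move=> nS; have [x [s1 [y [s2 [-> yx]]]]] : exists x s1 y s2,
    s = (x :: s1) ++ (y :: s2) /\ y < last x s1.
  case: s nS => // x s /=; elim: s x => //= y s IH x.
  rewrite negb_and; case: leqP => [_ /=|yx _]; last by exists x, [::], y, s.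
  by move=> /IH[x' [s1 [y' [s2 [-> H]]]]]; exists x, (x' :: s1), y', s2.
rewrite cyclic_descents_cat cat_cons cyclic_descentsE last_cat /= yx addn1 ltnS.
rewrite leqn0 descents0 => H; exists (x :: s1), (y :: s2); split=> //.
Qed.

Lemma pmap_cat_split b e v1 v2 : pmap b e = v1 ++ v2 ->
  exists p q, [/\ e = p ++ q, pmap b p = v1 & pmap b q = v2].
Proof.
elim: e v1 => [|x e IH] v1 /=.
  by case: v1 => // H; exists [::], [::].
case Ex: (b x) => [y|] /=; last first.
  by move=> /IH[p [q [-> <- <-]]]; exists (x :: p), q; rewrite /= Ex.
case: v1 => [|z v1] /=; first by move=> H; exists [::], (x :: e); rewrite /= Ex.
by case=> <- /IH[p [q [-> <- <-]]]; exists (x :: p), q; rewrite /= Ex.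
Qed.

Definition image_le b : rel 'I_n :=
  fun x y => if b x is Some x' then if b y is Some y' then x' <= y' else true else true.

Lemma pairwise_pmap b e : pairwise (image_le b) e = sorted leO (pmap b e).
Proof.
rewrite (sorted_pairwise leO_trans); elim: e => //= x e ->.
rewrite /image_le; case Ex: (b x) => [x'|] /=; last first.
  by rewrite (eq_all (a2 := predT)) ?all_predT.
congr (_ && _); elim: e => //= y e IH.
by rewrite IH; case: (b y).
Qed.

Lemma orientation_preserving_mul a b :
  orientation_preserving a -> orientation_preserving b ->
  orientation_preserving (a * b).
Proof.
rewrite /orientation_preserving => /cyclic_descents_split[s1 [s2 [Ea Sa]]].
move=> /cyclic_descents_split[v1 [v2 [/pmap_cat_split[p [q [E <- <-]]]]]].
rewrite -pmap_cat -pairwise_pmap pairwise_cat => /and3P[Aqp Pq Pp].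
have -> : images (a * b) = pmap b s1 ++ pmap b s2.
  rewrite -pmap_cat -Ea /images; elim: (enum _) => //= i e ->.
  by rewrite ffunE; case: (a i).
rewrite cyclic_descents_cat -pmap_cat; move: Sa; set t := s2 ++ s1 => St.
have Pe : pairwise (fun x y : 'I_n => x < y) (p ++ q).
  have := iota_ltn_sorted 0 n; rewrite -val_enum_ord sorted_map.
  rewrite sorted_pairwise; last by move=> y x z; apply: ltn_trans.
  by rewrite -E.
have mE x : (x \in p) || (x \in q) by rewrite -mem_cat -E mem_enum.
move: Pe; rewrite pairwise_cat => /and3P[Lpq Lp Lq].
have refl x : image_le b x x by rewrite /image_le; case: (b x).
have mono r : pairwise (fun x y : 'I_n => x < y) r -> pairwise (image_le b) r ->
    forall x y, x \in r -> y \in r -> x <= y -> image_le b x y.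
  elim: r => //= z r IH /andP[Hz Lr] /andP[Rz Rr] x y.
  rewrite !inE => /predU1P[->|xr] /predU1P[->|yr] xy //.
  - exact: (allP Rz).
  - by move: (allP Hz _ xr) => /=; rewrite ltnNge xy.
  - exact: IH.
have split_t : t = filter [in p] t ++ filter [in q] t.
  move: St; rewrite (sorted_pairwise leO_trans).
  elim: (t) => //= x r IH /andP[Hx /IH Er].
  have /orP[xp|xq] := mE x.
    have xq : x \notin q.
      by apply/negP=> xq; have := allrelP Lpq _ _ xp xq; rewrite ltnn.
    by rewrite xp (negPf xq) /= -Er.
  have nr : filter [in p] r = [::].
    apply/eqP; rewrite -(negbK (_ == _)) -has_filter; apply/hasPn=> y yr.
    apply/negP=> yp; have := allrelP Lpq _ _ yp xq.
    by rewrite ltnNge (allP Hx).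
  have xp : x \notin p.
    by apply/negP=> xp; have := allrelP Lpq _ _ xp xq; rewrite ltnn.
  by rewrite (negPf xp) xq nr /= {1}Er nr.
rewrite split_t pmap_cat cyclic_descents_cat -pmap_cat.
apply: sorted_cyclic_descents; rewrite -pairwise_pmap pairwise_cat.
apply/and3P; split.
- apply/allrelP=> x y; rewrite !mem_filter => /andP[xq _] /andP[yp _].
  exact: (allrelP Aqp).
- move: St; rewrite (sorted_pairwise leO_trans).
  move=> /(pairwise_filter [in q]); apply: (@sub_in_pairwise _ [in q]).
    by move=> x y xq yq /= xy; apply: (mono q).
  exact: filter_all.
- move: St; rewrite (sorted_pairwise leO_trans).
  move=> /(pairwise_filter [in p]); apply: (@sub_in_pairwise _ [in p]).
    by move=> x y xq yq /= xy; apply: (mono p).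
  exact: filter_all.
Qed.

Lemma orientation_preserving_1 : orientation_preserving (1 : PT n).
Proof.
apply: sorted_cyclic_descents; rewrite /images.
have -> : pmap (1 : PT n) (enum 'I_n) = enum 'I_n.
  by elim: (enum _) => //= i e ->; rewrite ffunE.
by have := iota_sorted 0 n; rewrite -val_enum_ord sorted_map.
Qed.

Lemma orientation_preserving_closed :
  monoid_closed (fun a : PT n => orientation_preserving a).
Proof.
by split; [apply: orientation_preserving_1 | apply: orientation_preserving_mul].
Qed.

End Closure.

(** * The monoid of orientation-preserving partial transformations *)

Record POP (n : nat) := MkPOP {
  POP_val :> PT n;
  _ : orientation_preserving POP_val
}.

HB.instance Definition _ n := [isSub for @POP_val n].
HB.instance Definition _ n := [Finite of POP n by <:].
HB.instance Definition _ n :=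
  SubChoice_isSubMonoid.Build (PT n) _ (POP n) (@orientation_preserving_closed n).

Definition OP (n : nat) : {set POP n} := [set a : POP n | transformation a].
Definition POPI (n : nat) : {set POP n} := [set a : POP n | partial_permutation a].

(* The cycle (1 2 ... n). *)
Definition rotation (n : nat) : 'S_n := perm (@ordS_inj n).
Definition C (n : nat) : {group 'S_n} := <[rotation n]>%G.

Definition PT_of_perm (n : nat) (s : 'S_n) : PT n := [ffun i => Some (s i)].

(* The copy in [POP n] of a set of permutations of the points. *)
Definition POP_of_perms (n : nat) (A : {set 'S_n}) : {set POP n} :=
  [set a : POP n | (a : PT n) \in [set PT_of_perm s | s in A]].

Lemma C_orientation_preserving (n : nat) (s : 'S_n) :
  s \in C n -> orientation_preserving (PT_of_perm s).
Proof.
have PM (u v : 'S_n) : PT_of_perm (u * v) = PT_of_perm u * PT_of_perm v.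
  by apply/ffunP=> i; rewrite !ffunE permM /= ffunE.
case/cycleP=> k ->; elim: k => [|k IH].
  rewrite expg0; have -> : PT_of_perm 1 = 1 :> PT n.
    by apply/ffunP=> i; rewrite !ffunE perm1.
  exact: orientation_preserving_1.
rewrite expgS PM; apply: orientation_preserving_mul => //.
rewrite /orientation_preserving.
suff -> : images (PT_of_perm (rotation n)) = rot 1 (enum 'I_n).
  rewrite /rot cyclic_descents_cat cat_take_drop; apply: sorted_cyclic_descents.
  by have := iota_sorted 0 n; rewrite -val_enum_ord sorted_map.
have -> : images (PT_of_perm (rotation n)) = map (@ordS n) (enum 'I_n).
  rewrite /images; elim: (enum _) => //= i e ->.
  by rewrite ffunE /= permE.
apply: (inj_map val_inj); rewrite map_rot val_enum_ord -map_comp.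
rewrite (eq_map (g := (fun i => i.+1 %% n) \o val)) // map_comp val_enum_ord.
case: n => // n in s k IH PM *.
apply: (@eq_from_nth _ 0) => [|i]; rewrite size_map ?size_rot // => Hi.
have {}Hi : i < n.+1 by rewrite size_iota in Hi.
rewrite (nth_map 0) ?size_iota // nth_iota // add0n /= rot1_cons nth_rcons size_iota.
move: Hi; rewrite ltnS leq_eqVlt => /predU1P[->|Hi].
  by rewrite ltnn eqxx modnn.
by rewrite Hi nth_iota // modn_small.
Qed.

(* Main.v *)
From mathcomp Require Import all_boot all_fingroup gseries cyclic maximal.
Require Import Defs.

Set Implicit Arguments.
Unset Strict Implicit.
Unset Printing Implicit Defensive.

Local Open Scope group_scope.

(** The rank never increases under products, so everything happens among the
    elements of rank [n] and [n - 1].  The elements of rank [n] are the units, and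
    they form the cyclic group [C n].  An element of rank [n - 1] is either a
    transformation or injective, never both ([rank_pred_injective]); let A be the
    set of the former and B the set of the latter.

    The main point is that any subsemigroup [M] containing [C n] and meeting both
    A and B is the whole monoid ([units_generate]).  Take [a] of rank [n - 1].
    Some point [i] is outside its domain, or has the same image as another point
    [j]; multiplying [a] by a rotation so that its image becomes the complement of
    [i], a suitable power is the idempotent [elem i o] that deletes [i],
    respectively sends [i] to [j], and fixes all other points ([elem_power]).
    For [a] in A, [i] and [j] may be taken to be neighbours.  Conjugating by
    rotations, [M] contains all deletions of a point and all maps collapsing a
    point onto a neighbour.  These generate all monotone partial maps
    ([monotone_ind]: move the values one step at a time towards the identity), and
    every orientation-preserving map is a rotation followed by a monotone map
    ([rotate_monotone]).

    Hence a maximal subsemigroup containing [C n] omits all of A or all of B.  The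
    complement of A and the complement of B are subsemigroups, by comparing ranks
    and domains, so they are the only two.  A maximal subsemigroup [M] not
    containing [C n] meets [C n] in a proper subgroup (or not at all), and is thus
    contained in, and equal to, the subsemigroup obtained from a maximal subgroup
    [L] of [C n].  The types follow because A and B together form one regular
    J-class ([J_class_rank_pred], [rank_pred_regular]); the count follows because
    the maximal subgroups of a cyclic group of order [n] correspond to the prime
    divisors of [n] ([maximal_cycle]). *)

(** * The cyclic group of rotations *)

Section Rotations.
Variable n : nat.
Implicit Types (i j : 'I_n) (s u : 'S_n).

Lemma rotationE i : rotation n i = ordS i.
Proof. by rewrite permE. Qed.

Lemma rotationX k i : (rotation n ^+ k) i = (i + k) %% n :> nat.
Proof.
elim: k => [|k IH]; first by rewrite expg0 perm1 addn0 modn_small.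
by rewrite expgSr permM rotationE /= IH -addn1 modnDml addn1 addnS.
Qed.

Lemma C_transitive i j : exists2 s, s \in C n & s i = j.
Proof.
exists (rotation n ^+ (j + (n - i))); first exact: mem_cycle.
apply: val_inj; rewrite /= rotationX addnCA subnKC; last exact: ltnW.
by rewrite modnDr modn_small.
Qed.

Lemma C_ordS s i : s \in C n -> s (ordS i) = ordS (s i).
Proof.
case/cycleP=> k ->; rewrite -!rotationE -!permM.
by rewrite -expgS -expgSr.
Qed.

Lemma ordS_neq i : 1 < n -> ordS i != i.
Proof.
move=> n1; rewrite -val_eqE /=; have := ltn_ord i.
rewrite leq_eqVlt => /predU1P[Ei|lt_i]; last by rewrite modn_small // gtn_eqF.
by rewrite Ei modnn; apply/eqP=> i0; rewrite -Ei -i0 in n1.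
Qed.

Lemma card_C : 0 < n -> #|C n| = n.
Proof.
move=> n0; pose i0 := Ordinal n0; apply/eqP; rewrite eqn_leq; apply/andP; split.
  apply: dvdn_leq => //; rewrite order_dvdn; apply/eqP/permP=> i.
  by apply: val_inj; rewrite /= rotationX perm1 modnDr modn_small.
apply: leq_trans (leq_imset_card (fun s : 'S_n => s i0) (mem (C n))).
rewrite -[X in X <= _]card_ord; apply/subset_leq_card/subsetP=> j _.
by have [s Cs <-] := C_transitive i0 j; apply: imset_f.
Qed.

Lemma map_rotation k :
  map (rotation n ^+ k) (enum 'I_n) = rot (k %% n) (enum 'I_n).
Proof.
case: (posnP n) => [n0|n0].
  by case: (enum 'I_n) (size_enum_ord n) => //; rewrite n0.
pose x0 := Ordinal n0.
have sE : size (enum 'I_n) = n by rewrite size_enum_ord.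
have kn : k %% n < n by rewrite ltn_pmod.
apply: (@eq_from_nth _ x0) => [|i]; rewrite size_map ?size_rot // sE => Hi.
rewrite (nth_map x0) ?sE //; apply: val_inj; rewrite /= rotationX.
rewrite nth_enum_ord // /rot nth_cat size_drop sE.
rewrite -modnDmr.
case: ltnP => Hk.
  rewrite nth_drop nth_enum_ord; last by rewrite -ltn_subRL.
  by rewrite addnC modn_small // -ltn_subRL.
have lt2 : (i - (n - k %% n)) < k %% n by rewrite ltn_subLR // subnK // ltnW.
rewrite nth_take // nth_enum_ord; last exact: ltn_trans kn.
have -> : (i + k %% n)%N = (i - (n - k %% n) + n)%N.
  by rewrite -{1}(subnK Hk) -addnA subnK // ltnW.
by rewrite modnDr modn_small // (ltn_trans lt2).
Qed.

End Rotations.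

(** * Rank and domain *)

Section Rank.
Variable n : nat.
Implicit Types (a b : PT n) (i j x : 'I_n) (s u : 'S_n) (D : {set 'I_n}).

Lemma mulE a b i : (a * b) i = obind b (a i).
Proof. by rewrite ffunE. Qed.

Lemma permTE s i : PT_of_perm s i = Some (s i).
Proof. by rewrite ffunE. Qed.

Lemma permT_M s u : PT_of_perm (s * u) = PT_of_perm s * PT_of_perm u.
Proof. by apply/ffunP=> i; rewrite mulE !permTE permM /= permTE. Qed.

Lemma permT_1 : PT_of_perm 1 = 1 :> PT n.
Proof. by apply/ffunP=> i; rewrite !ffunE perm1. Qed.

Lemma permT_inj : injective (@PT_of_perm n).
Proof.
by move=> s u /ffunP E; apply/permP=> i; have:= E i; rewrite !permTE => -[].
Qed.

Lemma permTVK s a : PT_of_perm s^-1 * (PT_of_perm s * a) = a.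
Proof. by rewrite mulgA -permT_M mulVg permT_1 mul1g. Qed.

Lemma imP a j : reflect (exists i, a i = Some j) (j \in im a).
Proof. by rewrite inE; apply: (iffP existsP) => -[i /eqP ai]; exists i; rewrite ai. Qed.

Lemma im_mulr a b : im (a * b) \subset im b.
Proof.
apply/subsetP=> j /imP[i]; rewrite mulE; case: (a i) => //= x bx.
by apply/imP; exists x.
Qed.

Lemma rank_le a : rank a <= n.
Proof. by rewrite -[X in _ <= X]card_ord max_card. Qed.

Lemma rank_mulr a b : rank (a * b) <= rank b.
Proof. exact/subset_leq_card/im_mulr. Qed.

Lemma rank_mull a b : rank (a * b) <= rank a.
Proof.
rewrite /rank -(card_imset (im (a * b)) (@Some_inj _)).
apply: leq_trans (leq_imset_card b (im a)).
apply/subset_leq_card/subsetP=> _ /imsetP[j /imP[i abi] ->].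
rewrite mulE in abi; case Ei: (a i) abi => [x|] //= <-.
by apply: imset_f; apply/imP; exists i.
Qed.

(** If the points of [D] account for the whole image of [a] and [D] has no more
    points than that image, then [a] is defined and injective on [D]. *)
Lemma rank_eq_image a D : #|D| <= rank a ->
    (forall j, j \in im a -> exists2 i, i \in D & a i = Some j) ->
  (forall i, i \in D -> a i != None) /\ {in D &, injective (fun i => a i)}.
Proof.
move=> leD imD.
have sub : Some @: im a \subset a @: D.
  by apply/subsetP=> _ /imsetP[j /imD[i Di <-] ->]; apply: imset_f.
have cS : #|Some @: im a| = rank a by rewrite card_imset //; apply: Some_inj.
have Eim : Some @: im a = a @: D.
  apply/eqP; rewrite eqEcard sub cS.
  exact: leq_trans (leq_imset_card a D) leD.
split.
  move=> i Di; have : a i \in Some @: im a by rewrite Eim imset_f.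
  by case/imsetP=> j _ ->.
apply/imset_injP; rewrite eqn_leq leq_imset_card -Eim cS //.
Qed.

Lemma rank_permTl s a : rank (PT_of_perm s * a) = rank a.
Proof.
apply/eqP; rewrite eqn_leq rank_mulr /=.
by rewrite -{1}(permTVK s a) rank_mulr.
Qed.

Lemma rank_permT s : rank (PT_of_perm s) = n.
Proof.
rewrite -[RHS]card_ord; apply: eq_card => j.
by apply/imP; exists (s^-1 j); rewrite permTE permKV.
Qed.

(** A partial map of rank [n] is a permutation. *)
Lemma rank_n_total a : rank a = n ->
  [/\ forall i, a i != None, injective (fun i => a i)
    & forall j, exists i, a i = Some j].
Proof.
move=> ra; have [||tot inj] := @rank_eq_image a setT.
- by rewrite cardsT card_ord ra.
- by move=> j /imP[i ai]; exists i; rewrite ?inE.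
split=> [i|i j Eij|j]; [by apply: tot; rewrite inE| by apply: inj; rewrite ?inE|].
suff /imP: j \in im a by [].
have -> : im a = setT; last by rewrite inE.
by apply/eqP; rewrite eqEcard subsetT cardsT card_ord [X in _ <= X]ra leqnn.
Qed.

Lemma transformationP a : reflect (forall i, a i != None) (transformation a).
Proof.
apply: (iffP eqP) => [E i|tot]; first by have := in_setT i; rewrite -E inE.
by apply/setP=> i; rewrite !inE tot.
Qed.

(** Among the partial maps of rank [n - 1], those with full domain and the
    injective ones are complementary. *)
Lemma rank_pred_injective a : 0 < n -> rank a = n - 1 ->
  partial_permutation a = ~~ transformation a.
Proof.
move=> n0 ra; case: (boolP (transformation a)) => /= [/transformationP tot|ntot].
  apply/negP=> /forallP inj.
  suff ran : rank a = n.
    by have := subnK n0; rewrite -ra ran addn1 => /eqP; rewrite eqn_leq ltnn.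
  have: #|a @: setT| = #|[set: 'I_n]|.
    apply: card_in_imset => i j _ _ Eij.
    have := inj i; rewrite inE tot /= => /forallP/(_ j).
    by rewrite inE tot /= Eij eqxx => /eqP.
  rewrite cardsT card_ord => En; apply: etrans En.
  rewrite /rank -(card_imset (im a) (@Some_inj _)); apply: eq_card => o.
  apply/imsetP/imsetP=> [[j /imP[i ai] ->]|[i _ ->]]; first by exists i.
  by case Ei: (a i) (tot i) => [j|] // _; exists j => //; apply/imP; exists i.
have le_dom : #|dom a| <= rank a.
  rewrite ra leq_subRL // add1n -[X in _ <= X]card_ord -cardsT.
  by apply: proper_card; rewrite properT.
have [||_ inj] := @rank_eq_image a (dom a) => //.
  by move=> j /imP[i ai]; exists i; rewrite // inE ai.
apply/forall_inP=> i di; apply/forall_inP=> j dj; apply/implyP=> /eqP Eij.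
exact/eqP/inj.
Qed.

Lemma rank_pred_missed a : 0 < n -> rank a = n - 1 -> exists j, j \notin im a.
Proof.
move=> n0 ra; have : im a \proper setT.
  by rewrite properEcard subsetT cardsT card_ord [X in X < _]ra subn1 prednK ?leqnn.
by case/properP=> _ [l _ nl]; exists l.
Qed.

End Rank.

(** * Elementary idempotents *)

Section Elementary.
Variable n : nat.
Implicit Types (a b : PT n) (i j x : 'I_n) (s u : 'S_n) (D : {set 'I_n}).
Implicit Types (o : option 'I_n) (P : PT n -> Prop).

(** The partial map that fixes every point other than [i], and is undefined at
    [i] or sends [i] to [j], according to whether [o] is [None] or [Some j]; it is
    the identity if [o] is [Some i]. *)
Definition elem i o : PT n := [ffun x => if x == i then o else Some x].

(** Adjacency in the cyclic order of the points. *)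
Definition adjacent i j : bool := (j == ordS i) || (i == ordS j).

Lemma elem_mul i o a : a i = obind a o -> elem i o * a = a.
Proof.
by move=> ai; apply/ffunP=> x; rewrite mulE ffunE; case: eqP => [->|].
Qed.

Lemma mul_elem a i o : i \notin im a -> a * elem i o = a.
Proof.
move=> /imP ni; apply/ffunP=> x; rewrite mulE; case Ex: (a x) => [y|] //=.
by rewrite ffunE; case: eqP => // Ey; case: ni; exists x; rewrite Ex Ey.
Qed.

Lemma elem_conj s i o :
  PT_of_perm s^-1 * elem i o * PT_of_perm s = elem (s i) (omap s o).
Proof.
apply/ffunP=> x; rewrite !mulE !ffunE /= ffunE -(inj_eq (@perm_inj _ s)) permKV.
case: eqP => _ /=; last by rewrite ffunE permKV.
by case: o => //= j; rewrite ffunE.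
Qed.

Lemma adjacent_rot s i j : s \in C n -> adjacent i j -> adjacent (s i) (s j).
Proof.
by move=> Cs /orP[]/eqP->; rewrite /adjacent (C_ordS _ Cs) eqxx ?orbT.
Qed.

(** If [i] and [o] record a defect of a partial map [a] of rank [n - 1] (either
    [i] lies outside the domain, or [i] has the same image as another point),
    then a rotation [s] turns [a * s] into [elem i o] followed by a permutation
    fixing [i], so that [elem i o] is a power of [a * s]. *)
Lemma elem_power P a i o :
    (forall b c, P b -> P c -> P (b * c)) ->
    (forall b s, s \in C n -> P b -> P (b * PT_of_perm s)) ->
    P a -> rank a = n - 1 -> a i = obind a o -> o != Some i ->
  P (elem i o).
Proof.
move=> PM PC Pa ra ai oi.
have n0 : 0 < n by apply: leq_ltn_trans (ltn_ord i).
have [l nl] := rank_pred_missed n0 ra.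
have [s Cs sl] := C_transitive l i.
set b := a * PT_of_perm s.
have Pb : P b by apply: PC.
have bi : b i = obind b o.
  by rewrite /b mulE ai; case: (o) => //= j; rewrite mulE.
have rb : rank b = n - 1.
  apply/eqP; rewrite eqn_leq -{1}ra rank_mull /= -ra.
  by rewrite -[X in rank X <= _]mulg1 -permT_1 -(mulgV s) permT_M mulgA rank_mull.
have ib : i \notin im b.
  apply/negP=> /imP[x]; rewrite /b mulE; case Ex: (a x) => [y|] //=.
  rewrite permTE -sl => -[/perm_inj Ey].
  by case/imP: nl; exists x; rewrite Ex Ey.
clearbody b.
(* [b] agrees off [i] with the permutation [t] below, which fixes [i]. *)
have [|j /imP[x bx]|tot inj] := @rank_eq_image _ b (~: [set i]).
- by rewrite cardsC1 card_ord rb subn1.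
- have [Ex|nx] := eqVneq x i; last by exists x; rewrite // !inE.
  move: bx; rewrite Ex bi; case Eo: (o) oi => [y|] //= yi by_j.
  by exists y => //; rewrite !inE; apply: contra yi => /eqP->.
pose f x := if x == i then i else odflt i (b x).
have fE x : x != i -> b x = Some (f x).
  move=> xi; rewrite /f (negPf xi).
  by case: (b x) (tot x) => //= /(_ _); rewrite !inE => /(_ xi).
have fi x : x != i -> f x != i.
  by move=> /fE bx; apply: contra ib => /eqP <-; apply/imP; exists x.
have f_inj : injective f.
  move=> x y; have [->|xi] := eqVneq x i; have [->|yi] := eqVneq y i => //.
  - by rewrite {1}/f eqxx => E; have:= fi y yi; rewrite -E eqxx.
  - by rewrite {2}/f eqxx => E; have:= fi x xi; rewrite E eqxx.
  by move=> E; apply: inj; rewrite ?inE // !fE ?E.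
pose t := perm f_inj.
have ti : t i = i by rewrite permE /f eqxx.
have bE : b = elem i o * PT_of_perm t.
  apply/ffunP=> x; rewrite mulE ffunE; case: eqP => [->|/eqP xi] /=.
    rewrite bi; case Eo: (o) oi => [y|] //= yi.
    by rewrite permTE permE -fE //; apply: contra yi => /eqP->.
  by rewrite permTE permE fE.
have Pk k : P (elem i o * PT_of_perm (t ^+ k.+1)).
  elim: k => [|k IH]; first by rewrite expg1 -bE.
  rewrite expgSr permT_M mulgA -[elem i o * PT_of_perm _](@mul_elem _ i o).
    by rewrite -mulgA -bE; apply: PM.
  apply/imP=> -[x]; rewrite mulE ffunE.
  have tk : (t ^+ k.+1) i = i.
    by elim: (k.+1) => [|m Em]; rewrite ?perm1 // expgSr permM Em ti.
  case: eqP => [_|/eqP xi] /=; last first.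
    rewrite permTE => -[E]; case/eqP: xi.
    by apply: (@perm_inj _ (t ^+ k.+1)); rewrite E tk.
  case Eo: (o) oi => [y|] //= yi; rewrite permTE => -[E]; case/eqP: yi.
  by congr Some; apply: (@perm_inj _ (t ^+ k.+1)); rewrite E tk.
have := Pk #[t].-1; rewrite prednK ?order_gt0 // expg_order permT_1 mulg1 //.
Qed.

End Elementary.

(** * Monotone partial maps *)

Section Monotone.
Variable n : nat.
Implicit Types (a b : PT n) (i j x y : 'I_n) (s u : 'S_n) (D : {set 'I_n}).
Implicit Types (o : option 'I_n) (P : PT n -> Prop).

(** Order preservation for the linear order, on the domain of [a]. *)
Definition monotone a := forall i j x y,
  i <= j -> a i = Some x -> a j = Some y -> x <= y.

Lemma monotone_sorted a :
  monotone a <-> sorted (fun x y : 'I_n => x <= y) (images a).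
Proof.
rewrite -pairwise_pmap; case: (posnP n) => [n0|n0].
  have -> : enum 'I_n = [::] by apply: size0nil; rewrite size_enum_ord.
  by split=> // _ i; have := ltn_ord i; rewrite {2}n0.
pose x0 := Ordinal n0; split=> [mono|/(pairwiseP x0) sorted_a i j x y].
  apply/(pairwiseP x0)=> i j; rewrite !inE size_enum_ord => Hi Hj ij.
  rewrite /image_le; case Ex: (a _) => [x|] //; case Ey: (a _) => [y|] //.
  by apply: mono Ex Ey; rewrite !nth_enum_ord // ltnW.
rewrite leq_eqVlt => /predU1P[/val_inj->->[->]//|ij] ai aj.
have := sorted_a i j; rewrite !inE size_enum_ord !ltn_ord !nth_ord_enum ij.
by move=> /(_ isT isT isT); rewrite /image_le ai aj.
Qed.

Lemma monotone_orientation_preserving a : monotone a -> orientation_preserving a.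
Proof. by move/monotone_sorted/sorted_cyclic_descents. Qed.

(** Rotating the domain turns an orientation-preserving map into a monotone one. *)
Lemma rotate_monotone a : orientation_preserving a ->
  exists2 s, s \in C n & monotone (PT_of_perm s * a).
Proof.
move=> /cyclic_descents_split[s1 [s2 [Ea Sa]]].
have [p [q [E Ep Eq]]] := pmap_cat_split Ea.
exists (rotation n ^+ size p); first exact: mem_cycle.
apply/monotone_sorted; rewrite /images.
have -> : pmap (PT_of_perm (rotation n ^+ size p) * a) (enum 'I_n)
    = pmap a (map (rotation n ^+ size p) (enum 'I_n)).
  by elim: (enum _) => //= i e <-; rewrite mulE permTE.
suff -> : map (rotation n ^+ size p) (enum 'I_n) = q ++ p by rewrite pmap_cat Ep Eq.
rewrite map_rotation; have : size p <= n.
  by have := leq_addr (size q) (size p); rewrite -size_cat -E size_enum_ord.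
rewrite leq_eqVlt => /predU1P[Ep_n|lt_p]; last first.
  by rewrite modn_small // E rot_size_cat.
have q0 : q = [::].
  apply: size0nil; apply/eqP; rewrite -(eqn_add2l (size p)) -size_cat -E.
  by rewrite size_enum_ord addn0 Ep_n.
by rewrite Ep_n modnn rot0 E q0 cats0.
Qed.

Let dist (i j : nat) := (i - j + (j - i))%N.

(* Neighbours in the linear order, without wrapping around. *)
Let consec i j := (i.+1 == j) || (j.+1 == i).

Let consec_adjacent i j : consec i j -> adjacent i j.
Proof.
case/orP=> /eqP E; apply/orP; [left|right]; apply/eqP/val_inj.
  by rewrite -[RHS]/(i.+1 %% n) E modn_small.
by rewrite -[RHS]/(j.+1 %% n) E modn_small.
Qed.

(** A monotone map either restricts the identity, or has a value [x] at some [i]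
    that may also be taken at a neighbour [j] of [i] closer to [x]: the largest [i]
    with [i < x], or the smallest [i] with [x < i], has this property. *)
Lemma monotone_step a : monotone a ->
  (forall i x, a i = Some x -> x = i) \/
  exists i j x, [/\ consec i j, a i = Some x, a j = None \/ a j = Some x
                  & dist x j < dist x i].
Proof.
move=> mono.
pose up i := oapp (fun x : 'I_n => i < x) false (a i).
pose down i := oapp (fun x : 'I_n => x < i) false (a i).
case: (pickP up) => [i0 up_i0|noup].
  right; case: (@arg_maxnP _ i0 up val up_i0) => i; rewrite /up.
  case Ei: (a i) => [x|] //= ix maxi.
  have jn : i.+1 < n by apply: leq_ltn_trans (ltn_ord x).
  exists i, (Ordinal jn), x; split=> //; first by rewrite /consec /= eqxx.
    case Ej: (a _) => [y|]; [right|by left].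
    have xy : x <= y by apply: mono Ei Ej => /=.
    have yi : y <= i.+1.
      rewrite leqNgt; apply/negP=> iy; have /= := maxi (Ordinal jn).
      by rewrite Ej /= iy ltnn => /(_ isT).
    congr Some; apply: val_inj; apply/eqP; rewrite eqn_leq xy andbT.
    exact: leq_trans yi ix.
  rewrite /dist /=; have /eqP-> : i.+1 - x == 0 by rewrite subn_eq0.
  have /eqP-> : i - x == 0 by rewrite subn_eq0 ltnW.
  by rewrite !addn0 subnS prednK ?subn_gt0.
case: (pickP down) => [i0 dn_i0|nodn].
  right; case: (@arg_minnP _ i0 down val dn_i0) => i; rewrite /down.
  case Ei: (a i) => [x|] //= xi mini.
  have i0' : 0 < i by apply: leq_ltn_trans xi.
  have jn : i.-1 < n by rewrite prednK //; apply: ltnW.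
  exists i, (Ordinal jn), x; split=> //.
    by rewrite /consec /= prednK ?eqxx ?orbT.
    case Ej: (a _) => [y|]; [right|by left].
    have yx : y <= x by apply: mono Ej Ei => /=; apply: leq_pred.
    have iy : i.-1 <= y.
      rewrite leqNgt; apply/negP=> iy; have /= := mini (Ordinal jn).
      by rewrite Ej /= iy leqNgt prednK // leqnn => /(_ isT).
    congr Some; apply: val_inj; apply/eqP; rewrite eqn_leq yx /=.
    by apply: leq_trans iy; rewrite -ltnS prednK.
  have xi' : x <= i.-1 by rewrite -ltnS prednK.
  rewrite /dist /=; have /eqP-> : x - i.-1 == 0 by rewrite subn_eq0.
  have /eqP-> : x - i == 0 by rewrite subn_eq0 ltnW.
  by rewrite !add0n ltn_sub2r // prednK.
left=> i x ai; apply: val_inj; apply/eqP.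
have := noup i; have := nodn i; rewrite /up /down ai /=.
by case: ltngtP.
Qed.

(** A monotone full map other than the identity sends two consecutive points to
    the same point. *)
Lemma monotone_total_collapse a : monotone a -> (forall i, a i != None) ->
  a = 1 \/ exists i j, [/\ adjacent i j, i != j & a i = a j].
Proof.
move=> mono tot; case: (monotone_step mono) => [sub1|[i [j [x [ij ai aj lt]]]]].
  left; apply/ffunP=> i; rewrite ffunE; case Ei: (a i) (tot i) => [x|] // _.
  by rewrite (sub1 _ _ Ei).
right; exists i, j; split; first exact: consec_adjacent.
  by apply: contraTneq lt => ->; rewrite ltnn.
by case: aj => aj; [have := tot j; rewrite aj|rewrite ai aj].
Qed.

(** The restriction of the identity to [D]. *)
Definition restr D : PT n := [ffun x => if x \in D then Some x else None].

Lemma restr_ind P : P 1 -> (forall b c, P b -> P c -> P (b * c)) ->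
  (forall i, P (elem i None)) -> forall D, P (restr D).
Proof.
move=> P1 PM Pe D; move: {2}#|~: D| (leqnn #|~: D|) => m.
elim: m D => [|m IH] D.
  rewrite leqn0 cards_eq0 => /eqP D0; suff -> : restr D = 1 by [].
  by apply/ffunP=> x; rewrite !ffunE -[x \in D]negbK -in_setC D0 inE.
case: (set_0Vmem (~: D)) => [D0 _|[i iD] leD].
  by apply: IH; rewrite D0 cards0.
suff -> : restr D = restr (i |: D) * elem i None.
  apply: PM => //; apply: IH; rewrite -ltnS; apply: leq_trans leD.
  apply: proper_card; apply/properP; split; last by exists i; rewrite // !inE eqxx.
  by apply/subsetP=> x; rewrite !inE negb_or => /andP[].
apply/ffunP=> x; rewrite mulE !ffunE !inE; case: eqP => [->|/eqP xi] /=.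
  by rewrite ffunE eqxx; move: iD; rewrite inE => /negPf->.
by case: (x \in D) => //=; rewrite ffunE (negPf xi).
Qed.

(** The monotone partial maps are generated by the identity and the elementary
    idempotents that delete a point or send a point to a neighbour.  The induction
    is on the total distance between the points of the domain and their values. *)
Lemma monotone_ind P : P 1 -> (forall b c, P b -> P c -> P (b * c)) ->
    (forall i, P (elem i None)) ->
    (forall i j, adjacent i j -> P (elem i (Some j))) ->
  forall a, monotone a -> P a.
Proof.
move=> P1 PM Pe Pt a.
pose d (i : 'I_n) o := oapp (fun x : 'I_n => dist x i) 0%N o.
pose mu b := (\sum_(i : 'I_n) d i (b i))%N.
move: {2}(mu a) (leqnn (mu a)) => m; elim: m a => [|m IH] a le_m mono.
all: case: (monotone_step mono) => [sub1|[i [j [x [ij ai aj lt]]]]].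
1, 3: suff -> : a = restr (dom a) by apply: restr_ind.
1, 2: apply/ffunP=> i; rewrite !ffunE inE; case Ei: (a i) => [x|] //=.
1, 2: by rewrite (sub1 _ _ Ei).
  move: le_m; rewrite leqn0 /mu (bigD1 i) //= ai /= addn_eq0 => /andP[/eqP di _].
  by rewrite di in lt.
have ji : j != i by apply: contraTneq lt => ->; rewrite ltnn.
(* The value of [a] at [i] is moved to the neighbour [j], which is closer to it. *)
pose b : PT n :=
  [ffun y => if y == i then None else if y == j then Some x else a y].
have -> : a = restr (dom a) * (elem i (Some j) * b).
  apply/ffunP=> y; rewrite !mulE !ffunE inE; case Ey: (a y) => [z|] //=.
  rewrite mulE !ffunE; case: eqP => [Eyi|/eqP yi] /=.
    by rewrite ffunE (negPf ji) eqxx -ai -Ey Eyi.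
  rewrite ffunE (negPf yi); case: eqP => [Eyj|//].
  by rewrite Eyj in Ey; case: aj Ey => -> // -[->].
apply: (PM); first by apply: restr_ind.
apply: (PM); first by apply: Pt; apply: consec_adjacent.
have bj : b j = Some x by rewrite ffunE (negPf ji) eqxx.
have bi : b i = None by rewrite ffunE eqxx.
have bE y : y != i -> y != j -> b y = a y.
  by move=> yi yj; rewrite ffunE (negPf yi) (negPf yj).
apply: IH.
  rewrite -ltnS; apply: leq_trans le_m.
  have muE c : mu c = (d i (c i) + (d j (c j) +
      \sum_(k | (k != i) && (k != j)) d k (c k)))%N.
    by rewrite /mu (bigD1 i) //= (bigD1 j).
  rewrite !muE bi bj ai /= add0n -addSn; apply: leq_add => //.
  rewrite (eq_bigr (fun k => d k (a k))) ?leq_addl // => k /andP[ki kj].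
  by rewrite bE.
move=> k l y z kl.
have [->|ki] := eqVneq k i; first by rewrite bi.
have [->|li] := eqVneq l i; first by rewrite bi.
(* No point lies strictly between [i] and [j]. *)
have ij_side (c : 'I_n) : 
    c != i -> c != j -> (c <= j -> c <= i) /\ (j <= c -> i <= c).
  rewrite -!val_eqE /= => ci cj; case/orP: ij => /eqP E; split.
  - by rewrite leq_eqVlt (negPf cj) /= -E ltnS.
  - by rewrite -E; apply: ltnW.
  - by rewrite -E; apply: leqW.
  - by rewrite -E leq_eqVlt eq_sym (negPf cj) /= .
have [Ek|kj] := eqVneq k j; have [El|lj] := eqVneq l j.
- by rewrite Ek El bj => -[->] [->].
- rewrite Ek bj bE // => -[<-]; apply: mono ai.
  by apply: (ij_side l li lj).2; rewrite -Ek.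
- rewrite El bj bE // => ak [<-]; apply: mono ak ai.
  by apply: (ij_side k ki kj).1; rewrite -El.
by rewrite !bE //; apply: mono.
Qed.

(** The orientation-preserving permutations are the rotations. *)
Lemma rank_n_rotation a : orientation_preserving a -> rank a = n ->
  exists2 s, s \in C n & a = PT_of_perm s.
Proof.
move=> /rotate_monotone[s Cs mono] ra.
have [|tot inj _] := @rank_n_total _ (PT_of_perm s * a).
  by rewrite rank_permTl.
exists s^-1; first by rewrite groupV.
case: (monotone_total_collapse mono tot) => [E|[i [j [_ /eqP ij /inj //]]]].
by rewrite -(permTVK s a) E mulg1.
Qed.

(** Two points on which a transformation of rank [n - 1] agrees can be chosen to be
    neighbours in the cyclic order. *)
Lemma rank_pred_collapse a : 0 < n -> orientation_preserving a -> rank a = n - 1 ->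
    transformation a ->
  exists i j, [/\ adjacent i j, i != j & a i = a j].
Proof.
move=> n0 /rotate_monotone[s Cs mono] ra /transformationP tot.
have tot' i : (PT_of_perm s * a) i != None by rewrite mulE permTE; apply: tot.
case: (monotone_total_collapse mono tot') => [E|[i [j [ij nij]]]].
  have := rank_permTl s a; rewrite E -permT_1 rank_permT ra => E'.
  by have := subnK n0; rewrite -E' addn1 => /eqP; rewrite eqn_leq ltnn.
rewrite !mulE !permTE /= => Eij; exists (s i), (s j); split=> //.
  exact: adjacent_rot.
by rewrite (inj_eq perm_inj).
Qed.

End Monotone.

(** * Maximal subsemigroups *)

Section MaximalSubsemigroups.
Variables (S : finType) (op : S -> S -> S).
Implicit Types M N : {set S}.

Lemma subsemigroupP M :
  reflect (M != set0 /\ forall a b, a \in M -> b \in M -> op a b \in M)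
          (subsemigroup op M).
Proof.
apply: (iffP andP) => -[M0 MM]; split=> //.
  by move=> a b Ma Mb; move/forall_inP: MM => /(_ a Ma)/forall_inP; apply.
by apply/forall_inP=> a Ma; apply/forall_inP=> b Mb; apply: MM.
Qed.

Lemma maximal_subsemigroupP M :
  reflect [/\ subsemigroup op M, M != setT &
              forall N, subsemigroup op N -> M \subset N -> N = M \/ N = setT]
          (maximal_subsemigroup op M).
Proof.
apply: (iffP maxsetP) => [[/andP[sM pM] maxM]|[sM nT maxM]].
  split=> [//||N sN MN]; first by rewrite -properT.
  case: (eqVneq N setT) => [->|NT]; [by right|left].
  by apply: maxM; rewrite // sN properT.
split=> [|N /andP[sN pN] MN]; first by rewrite sM properT.
by case: (maxM N sN MN) => // NT; rewrite NT properxx in pN.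
Qed.

Lemma maximal_subsemigroup_eq M N : maximal_subsemigroup op M ->
  subsemigroup op N -> N != setT -> M \subset N -> M = N.
Proof.
move=> /maximal_subsemigroupP[_ _ maxM] sN NT MN.
by case: (maxM N sN MN) => // E; rewrite E eqxx in NT.
Qed.

End MaximalSubsemigroups.

(** * Generation by units and elements of rank [n - 1] *)

Section POPn.
Variable n : nat.
Hypothesis n2 : 1 < n.
Let n_gt0 : 0 < n := ltnW n2.
Implicit Types (a b c x y z : POP n) (i j : 'I_n) (s u : 'S_n).
Implicit Types (o : option 'I_n) (M N : {set POP n}) (K L : {group 'S_n}).

Local Notation mulS := (@mul (POP n)).

Lemma POP_valM a b : POP_val (a * b) = POP_val a * POP_val b.
Proof. by []. Qed.

Lemma POP_orientation_preserving a : orientation_preserving (POP_val a).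
Proof. exact: valP a. Qed.

(** A rotation as an element of the monoid. *)
Definition POP_perm s (Cs : s \in C n) : POP n :=
  MkPOP (C_orientation_preserving Cs).

Lemma POP_of_permsP (A : {set 'S_n}) a :
  reflect (exists2 s, s \in A & POP_val a = PT_of_perm s) (a \in POP_of_perms A).
Proof. by rewrite inE; apply: imsetP. Qed.

Lemma POP_of_perms_inj (A : {set 'S_n}) s a :
  POP_val a = PT_of_perm s -> (a \in POP_of_perms A) = (s \in A).
Proof.
move=> Ea; apply/POP_of_permsP/idP=> [[u Au]|As]; last by exists s.
by rewrite Ea => /permT_inj->.
Qed.

(** The group of units consists of the elements of rank [n]. *)
Lemma mem_units a : (a \in POP_of_perms (C n)) = (rank a == n).
Proof.
apply/POP_of_permsP/eqP=> [[s _ ->]|/rank_n_rotation]; first exact: rank_permT.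
by apply; apply: POP_orientation_preserving.
Qed.

Lemma monotone_deletion i : monotone (elem i None).
Proof.
move=> j k x y jk; rewrite !ffunE.
by case: eqP => // _ [<-]; case: eqP => // _ [<-].
Qed.

(** The restriction of the identity to the complement of [i]. *)
Definition deletion i : POP n :=
  MkPOP (monotone_orientation_preserving (@monotone_deletion i)).

Lemma rank_deletion i : rank (elem i None) = n - 1.
Proof.
rewrite -[X in X - 1]card_ord subn1 -(cardsC1 i); apply: eq_card => j.
rewrite !inE; apply/existsP/idP => [[k]|ji]; last first.
  by exists j; rewrite ffunE (negPf ji).
by rewrite ffunE; case: (eqVneq k i) => // ki /eqP[<-].
Qed.

Lemma deletion_not_total i : ~~ transformation (elem i None).
Proof. by apply/negP=> /transformationP/(_ i); rewrite ffunE eqxx. Qed.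

Lemma monotone_collapse i j : j.+1 = i :> nat -> monotone (elem i (Some j)).
Proof.
move=> ji k l x y kl; rewrite !ffunE.
have [Ek|ki] := eqVneq k i; have [El|li] := eqVneq l i => -[<-] [<-] //.
  by apply: ltnW; rewrite ji -Ek.
by rewrite -ltnS ji -El ltn_neqAle kl El andbT.
Qed.

Definition collapse : POP n := MkPOP (monotone_orientation_preserving
  (@monotone_collapse (Ordinal n2) (Ordinal n_gt0) erefl)).

Lemma rank_collapse : rank collapse = n - 1.
Proof.
rewrite -[X in X - 1]card_ord subn1 -(cardsC1 (Ordinal n2)); apply: eq_card => j.
rewrite !inE; apply/existsP/idP => [[k]|ji]; last first.
  by exists j; rewrite ffunE (negPf ji).
by rewrite ffunE; case: (eqVneq k (Ordinal n2)) => [_ /eqP[<-]|ki /eqP[<-]].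
Qed.

Lemma collapse_total : transformation collapse.
Proof. by apply/transformationP=> i; rewrite ffunE; case: ifP. Qed.

(** A subsemigroup containing the units is everything as soon as it contains a
    transformation and a properly partial map of rank [n - 1]. *)
Lemma units_generate M a b :
    subsemigroup mulS M -> POP_of_perms (C n) \subset M ->
    a \in M -> transformation a -> rank a = n - 1 ->
    b \in M -> ~~ transformation b -> rank b = n - 1 ->
  M = setT.
Proof.
move=> /subsemigroupP[_ MM] UM Ma ta ra Mb ntb rb.
pose P t := exists2 x, x \in M & POP_val x = t.
have PM t v : P t -> P v -> P (t * v).
  by move=> [x Mx <-] [y My <-]; exists (x * y); rewrite ?MM.
have PC s : s \in C n -> P (PT_of_perm s).
  move=> Cs; exists (POP_perm Cs) => //; apply: (subsetP UM).
  by rewrite (POP_of_perms_inj _ (s := s)).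
have PCr t s : s \in C n -> P t -> P (t * PT_of_perm s).
  by move=> Cs Pt; apply: PM => //; apply: PC.
have Pconj s i o : s \in C n -> P (elem i o) -> P (elem (s i) (omap s o)).
  move=> Cs Pi; rewrite -elem_conj; apply: PCr => //.
  by apply: PM => //; apply: PC; rewrite groupV.
have Pa : P a by exists a.
have Pb : P b by exists b.
have Pdel i : P (elem i None).
  have [j bj] : exists j, POP_val b j = None.
    case: (pickP (fun j => POP_val b j == None)) => [j /eqP|noN]; first by exists j.
    by case/negP: ntb; apply/transformationP=> j; rewrite noN.
  have [s Cs <-] := C_transitive j i.
  by apply: (Pconj s j None Cs); apply: elem_power PM PCr Pb rb _ _.
have Pcol i j : adjacent i j -> P (elem i (Some j)).
  have [k [l [kl nkl akl]]] :=
    rank_pred_collapse n_gt0 (POP_orientation_preserving a) ra ta.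
  have Pkl : P (elem k (Some l)).
    apply: (@elem_power n P a k (Some l) PM PCr Pa ra akl).
    by apply: contra nkl => /eqP[->].
  have Plk : P (elem l (Some k)).
    apply: (@elem_power n P a l (Some k) PM PCr Pa ra (esym akl)).
    by apply: contra nkl => /eqP[->].
  have PS m : P (elem m (Some (ordS m))) /\ P (elem (ordS m) (Some m)).
    case/orP: kl => /eqP E.
      have [s Cs <-] := C_transitive k m; rewrite -(C_ordS _ Cs) -E.
      by split; [apply: (Pconj s k (Some l))|apply: (Pconj s l (Some k))].
    have [s Cs <-] := C_transitive l m; rewrite -(C_ordS _ Cs) -E.
    by split; [apply: (Pconj s l (Some k))|apply: (Pconj s k (Some l))].
  by case/orP=> /eqP->; [apply: (PS i).1|apply: (PS j).2].
apply/setP=> c; rewrite inE.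
have [s Cs mono] := rotate_monotone (POP_orientation_preserving c).
suff [x Mx /val_inj <-] : P c by [].
rewrite -(permTVK s c); apply: (PM); first by apply: PC; rewrite groupV.
by apply: monotone_ind mono => //; rewrite -(permT_1 n); apply: PC.
Qed.

(** * The three families of maximal subsemigroups *)

(** The identity together with the rotations lying in [N]; the identity is added so
    that this is a group even when [N] contains no rotation. *)
Definition rotations_in N : {set 'S_n} :=
  1 |: [set s in C n | [exists a in N, POP_val a == PT_of_perm s]].

Lemma rotations_in_group N : subsemigroup mulS N -> group_set (rotations_in N).
Proof.
move=> /subsemigroupP[_ NN]; apply/group_setP; split=> [|s u]; first exact: setU11.
rewrite !inE => /predU1P[->|/andP[Cs /exists_inP[a Na /eqP Ea]]].
  by rewrite mul1g.
case/predU1P=> [->|/andP[Cu /exists_inP[b Nb /eqP Eb]]].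
  by rewrite mulg1 Cs; apply/orP; right; apply/exists_inP; exists a; rewrite ?Ea.
rewrite groupM //=; apply/orP; right; apply/exists_inP; exists (a * b).
  exact: NN.
by rewrite permT_M -Ea -Eb.
Qed.

Lemma rotations_in_sub N : rotations_in N \subset C n.
Proof. by apply/subsetP=> s; rewrite !inE => /predU1P[->|/andP[]]. Qed.

Lemma rotations_inP N s a : POP_val a = PT_of_perm s -> s \in C n -> a \in N ->
  s \in rotations_in N.
Proof.
move=> Ea Cs Na; rewrite !inE Cs /=; apply/orP; right.
by apply/exists_inP; exists a; rewrite ?Ea.
Qed.

Lemma mem_of_rotations_in N s a : 1 \in N -> POP_val a = PT_of_perm s ->
  s \in rotations_in N -> a \in N.
Proof.
move=> N1 Ea; rewrite !inE => /predU1P[s1|/andP[_ /exists_inP[b Nb /eqP Eb]]].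
  by rewrite (_ : a = 1) //; apply: val_inj; rewrite /= Ea s1 permT_1.
by rewrite (_ : a = b) //; apply: val_inj; rewrite /= Ea Eb.
Qed.

Local Notation setA L := (~: POP_of_perms (C n) :|: POP_of_perms L).
Local Notation setB := (~: [set a in OP n | rank a == n - 1]).
Local Notation setC := (~: [set a in POPI n | rank a == n - 1]).

Lemma mem_setB a : (a \in setB) = ~~ (transformation a && (rank a == n - 1)).
Proof. by rewrite !inE. Qed.

Lemma mem_setC a : (a \in setC) = ~~ (~~ transformation a && (rank a == n - 1)).
Proof.
rewrite !inE; case: eqP => ra; last by rewrite !andbF.
by rewrite rank_pred_injective.
Qed.

Lemma rank_predF a : rank a = n - 1 -> (rank a == n) = false.
Proof.
move=> ->; apply/eqP => E; have := subnK n_gt0; rewrite E addn1 => /eqP.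
by rewrite eqn_leq ltnn.
Qed.

Lemma rank_predP a : n - 1 <= rank a -> rank a = n \/ rank a = n - 1.
Proof.
move=> le; have := rank_le a; rewrite leq_eqVlt => /predU1P[|lt]; first by left.
by right; apply/eqP; rewrite eqn_leq le andbT leq_subRL // add1n.
Qed.

Lemma rank_n_transformation a : rank a = n -> transformation a.
Proof. by case/rank_n_total=> tot _ _; apply/transformationP. Qed.

Lemma transformation_mul a b : transformation a -> transformation b ->
  transformation (a * b).
Proof.
move=> /transformationP ta /transformationP tb; apply/transformationP=> i.
by rewrite mulE; case: (POP_val a i) (ta i) => //= x _; apply: tb.
Qed.

Lemma transformation_mull a b : transformation (a * b) -> transformation a.
Proof.
move=> /transformationP tab; apply/transformationP=> i.
by have := tab i; rewrite mulE; case: (POP_val a i).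
Qed.

Lemma setB_subsemigroup : subsemigroup mulS setB.
Proof.
apply/subsemigroupP; split.
  apply/set0Pn; exists (deletion (Ordinal n2)).
  by rewrite mem_setB negb_and deletion_not_total.
move=> a b; rewrite !mem_setB => nA nB; apply/negP=> /andP[tab /eqP rab].
have ta := transformation_mull tab; rewrite ta /= in nA.
have [ra|ra] := rank_predP (leq_trans (eq_leq (esym rab)) (rank_mull a b)).
  have [_ _ sur] := rank_n_total ra.
  case/negP: nB; rewrite eqn_leq -{2}rab rank_mulr andbT; apply/andP; split.
    apply/transformationP=> j; have [i ai] := sur j.
    by have /transformationP/(_ i) := tab; rewrite mulE ai.
  rewrite -rab; apply/subset_leq_card/subsetP=> j /imP[k bk].
  by have [i ai] := sur k; apply/imP; exists i; rewrite mulE ai.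
by rewrite ra eqxx in nA.
Qed.

Lemma setC_subsemigroup : subsemigroup mulS setC.
Proof.
apply/subsemigroupP; split.
  by apply/set0Pn; exists collapse; rewrite mem_setC collapse_total.
move=> a b; rewrite !mem_setC => nA nB; apply/negP=> /andP[ntab /eqP rab].
have tot c : n - 1 <= rank c -> ~~ (~~ transformation c && (rank c == n - 1)) ->
    transformation c.
  case/rank_predP=> [/rank_n_transformation //|->]; by rewrite eqxx andbT negbK.
case/negP: ntab; apply: transformation_mul; apply: tot => //.
  by rewrite -rab rank_mull.
by rewrite -rab rank_mulr.
Qed.

Lemma units_sub_setB : POP_of_perms (C n) \subset setB.
Proof.
apply/subsetP=> a; rewrite mem_units mem_setB => /eqP ra.
apply/negP=> /andP[_ /eqP/rank_predF].
by rewrite ra eqxx.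
Qed.

Lemma units_sub_setC : POP_of_perms (C n) \subset setC.
Proof.
apply/subsetP=> a; rewrite mem_units mem_setC => /eqP ra.
apply/negP=> /andP[_ /eqP/rank_predF].
by rewrite ra eqxx.
Qed.

Lemma collapse_in_setC : collapse \in setC.
Proof. by rewrite mem_setC collapse_total. Qed.

Lemma collapse_notin_setB : collapse \notin setB.
Proof. by rewrite mem_setB collapse_total rank_collapse eqxx. Qed.

Lemma deletion_in_setB i : deletion i \in setB.
Proof. by rewrite mem_setB negb_and deletion_not_total. Qed.

Lemma deletion_notin_setC i : deletion i \notin setC.
Proof. by rewrite mem_setC deletion_not_total rank_deletion eqxx. Qed.

Lemma setB_maximal : maximal_subsemigroup mulS setB.
Proof.
apply/maximal_subsemigroupP; split; first exact: setB_subsemigroup.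
  by apply/eqP=> E; have := collapse_notin_setB; rewrite E inE.
move=> N sN BN; case: (boolP (N \subset setB)) => [NB|/subsetPn[a Na]].
  by left; apply/eqP; rewrite eqEsubset NB.
rewrite mem_setB negbK => /andP[ta /eqP ra]; right.
apply: (units_generate sN (subset_trans units_sub_setB BN) Na ta ra
  (subsetP BN _ (deletion_in_setB (Ordinal n2)))).
  exact: deletion_not_total.
exact: rank_deletion.
Qed.

Lemma setC_maximal : maximal_subsemigroup mulS setC.
Proof.
apply/maximal_subsemigroupP; split; first exact: setC_subsemigroup.
  by apply/eqP=> E; have := deletion_notin_setC (Ordinal n2); rewrite E inE.
move=> N sN CN; case: (boolP (N \subset setC)) => [NC|/subsetPn[a Na]].
  by left; apply/eqP; rewrite eqEsubset NC.
rewrite mem_setC negbK => /andP[ta /eqP ra]; right.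
exact: (units_generate sN (subset_trans units_sub_setC CN)
  (subsetP CN _ collapse_in_setC) collapse_total rank_collapse Na ta ra).
Qed.

Lemma one_in_units : 1 \in POP_of_perms (C n).
Proof. by rewrite (POP_of_perms_inj _ (s := 1)) ?permT_1. Qed.

Lemma mem_setA L a s : POP_val a = PT_of_perm s -> s \in C n ->
  (a \in setA L) = (s \in L).
Proof.
move=> Ea Cs; rewrite inE (POP_of_perms_inj L Ea).
by rewrite inE (POP_of_perms_inj (C n) Ea) Cs.
Qed.

Lemma setA_subsemigroup L : L \subset C n -> subsemigroup mulS (setA L).
Proof.
move=> LC; apply/subsemigroupP; split.
  by apply/set0Pn; exists 1; rewrite (mem_setA L (s := 1)) ?group1 // permT_1.
move=> a b Aa Ab; case: (boolP (a * b \in POP_of_perms (C n))) => [|nU]; last first.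
  by rewrite in_setU in_setC nU.
rewrite mem_units => /eqP rab.
have ra : rank a == n by rewrite eqn_leq rank_le -{1}rab rank_mull.
have rb : rank b == n by rewrite eqn_leq rank_le -{1}rab rank_mulr.
move: ra rb; rewrite -!mem_units => /POP_of_permsP[s Cs Es] /POP_of_permsP[u Cu Eu].
have Esu : POP_val (a * b) = PT_of_perm (s * u) by rewrite permT_M -Es -Eu.
rewrite (mem_setA L Es Cs) in Aa; rewrite (mem_setA L Eu Cu) in Ab.
by rewrite (mem_setA L Esu) groupM.
Qed.

Lemma setA_proper L : L \proper C n -> setA L != setT.
Proof.
case/properP=> _ [s Cs nL]; apply/eqP=> /setP/(_ (POP_perm Cs)).
by rewrite (mem_setA L (s := s)) // (negPf nL) inE.
Qed.

Lemma setA_maximal L : maximal L (C n) -> maximal_subsemigroup mulS (setA L).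
Proof.
move=> maxL; have [pL _] := maxgroupP maxL; have LC := proper_sub pL.
apply/maximal_subsemigroupP; split; [exact: setA_subsemigroup|exact: setA_proper|].
move=> N sN AN; pose K := Group (rotations_in_group sN).
have AE a : a \notin POP_of_perms (C n) -> a \in N.
  by move=> nU; apply: (subsetP AN); rewrite in_setU in_setC nU.
have N1 : 1 \in N.
  by apply: (subsetP AN); rewrite (mem_setA L (s := 1)) ?group1 // permT_1.
have LK : L \subset K.
  apply/subsetP=> s Ls; have Cs := subsetP LC s Ls.
  apply: (@rotations_inP N s (POP_perm Cs)) => //; apply: (subsetP AN).
  by rewrite (mem_setA L (s := s)).
have /maximal_eqP[_ /(_ K LK (rotations_in_sub N))] : maximal_eq L (C n).
  by rewrite /maximal_eq maxL orbT.
case=> EK; [left|right].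
  apply/eqP; rewrite eqEsubset AN andbT; apply/subsetP=> a Na.
  case: (boolP (a \in POP_of_perms (C n))) =>
    [/POP_of_permsP[s Cs Es]|nU]; last by rewrite in_setU in_setC nU.
  by rewrite (mem_setA L Es) // -EK; apply: (rotations_inP Es Cs Na).
apply/setP=> a; rewrite inE.
case: (boolP (a \in POP_of_perms (C n))) => [/POP_of_permsP[s Cs Es]|/AE //].
by apply: mem_of_rotations_in N1 Es _; move/setP: EK => ->.
Qed.

(** A maximal subsemigroup that omits a unit comes from a maximal subgroup of the
    group of units. *)
Lemma maximal_subsemigroup_units M : maximal_subsemigroup mulS M ->
  ~~ (POP_of_perms (C n) \subset M) ->
  exists L, maximal L (C n) /\ M = setA L.
Proof.
move=> maxM /subsetPn[a /POP_of_permsP[s Cs Es] nMa].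
have /maximal_subsemigroupP[sM _ _] := maxM.
pose K := Group (rotations_in_group sM).
have pK : K \proper C n.
  rewrite properEneq rotations_in_sub andbT; apply/eqP=> EK.
  case: (boolP (1 \in M)) => [M1|nM1].
    by case/negP: nMa; apply: mem_of_rotations_in M1 Es _; move/setP: EK => ->.
  (* If [M] contained all rotations but the identity, a power of one of them
     would put the identity in [M]. *)
  have r1 : rotation n != 1.
    apply/eqP=> /permP/(_ (Ordinal n2))/eqP.
    by rewrite perm1 rotationE (negPf (ordS_neq _ n2)).
  have : rotation n \in rotations_in M by move/setP: EK => ->; apply: cycle_id.
  rewrite !inE (negPf r1) /= => /andP[_ /exists_inP[b Mb /eqP Eb]].
  have /subsemigroupP[_ MM] := sM.
  have Mk k : exists2 c, c \in M & POP_val c = PT_of_perm (rotation n ^+ k.+1).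
    elim: k => [|k [c Mc Ec]]; first by exists b.
    by exists (c * b); [apply: MM|rewrite expgSr permT_M -Ec -Eb].
  have [c Mc Ec] := Mk #[rotation n].-1.
  rewrite prednK ?order_gt0 // expg_order permT_1 in Ec.
  by case/negP: nM1; rewrite (_ : 1 = c) //; apply: val_inj.
have [EK|[L maxL KL]] := maximal_exists (proper_sub pK).
  by move: pK; rewrite EK properxx.
exists L; split=> //; have [pL _] := maxgroupP maxL.
apply: (maximal_subsemigroup_eq maxM).
- exact/setA_subsemigroup/proper_sub.
- exact: setA_proper.
apply/subsetP=> b Mb.
case: (boolP (b \in POP_of_perms (C n))) =>
    [/POP_of_permsP[u Cu Eu]|nU]; last by rewrite in_setU in_setC nU.
by rewrite (mem_setA L Eu) //; apply: (subsetP KL); apply: rotations_inP Eu Cu Mb.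
Qed.

Lemma maximal_subsemigroup_POP M : maximal_subsemigroup mulS M <->
  [\/ exists L, maximal L (C n) /\ M = setA L, M = setB | M = setC].
Proof.
split=> [maxM|[[L [maxL ->]]|->|->]]; last first.
- exact: setC_maximal.
- exact: setB_maximal.
- exact: setA_maximal.
case: (boolP (POP_of_perms (C n) \subset M)) => [UM|nUM]; last first.
  by apply: Or31; apply: maximal_subsemigroup_units.
have /maximal_subsemigroupP[sM MT _] := maxM.
have eqM N : maximal_subsemigroup mulS N -> M \subset N -> M = N.
  by case/maximal_subsemigroupP=> sN NT _; apply: maximal_subsemigroup_eq maxM sN NT.
case: (boolP (M \subset setB)) => [MB|/subsetPn[a Ma]].
  by apply: Or32; apply: eqM MB; apply: setB_maximal.
rewrite mem_setB negbK => /andP[ta /eqP ra].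
case: (boolP (M \subset setC)) => [MC|/subsetPn[b Mb]].
  by apply: Or33; apply: eqM MC; apply: setC_maximal.
rewrite mem_setC negbK => /andP[tb /eqP rb].
by move: MT; rewrite (units_generate sM UM Ma ta ra Mb tb rb) eqxx.
Qed.

End POPn.

(** * Types of the maximal subsemigroups *)

Section Types.
Variable n : nat.
Hypothesis n2 : 1 < n.
Let n_gt0 : 0 < n := ltnW n2.
Implicit Types (a b c x y z : POP n) (i j : 'I_n) (s u : 'S_n).
Implicit Types (o : option 'I_n) (M N : {set POP n}) (K L : {group 'S_n}).

Local Notation mulS := (@mul (POP n)).
Local Notation setA L := (~: POP_of_perms (C n) :|: POP_of_perms L).
Local Notation setB := (~: [set a in OP n | rank a == n - 1]).
Local Notation setC := (~: [set a in POPI n | rank a == n - 1]).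

Lemma two_sided_idealP a b :
  reflect (exists x y, b = x * a * y) (b \in two_sided_ideal mulS a).
Proof.
apply: (iffP imset2P) => [[x y _ _ ->]|[x [y ->]]]; first by exists x, y.
by exists x y; rewrite ?inE.
Qed.

Lemma green_J_intro a b x y z t : a = x * b * y -> b = z * a * t -> green_J mulS a b.
Proof.
move=> ab ba; apply/eqP/setP=> c.
apply/two_sided_idealP/two_sided_idealP=> [[u [v ->]]|[u [v ->]]].
  by exists (u * x), (y * v); rewrite ab !mulgA.
by exists (u * z), (t * v); rewrite ba !mulgA.
Qed.

Lemma green_J_rank a b : green_J mulS a b -> rank a = rank b.
Proof.
have le c d : green_J mulS c d -> rank c <= rank d.
  move=> /eqP E; have : c \in two_sided_ideal mulS d.
    by rewrite -E; apply/two_sided_idealP; exists 1, 1; rewrite mul1g mulg1.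
  case/two_sided_idealP=> x [y ->].
  exact: leq_trans (rank_mull _ _) (rank_mulr _ _).
by move=> ab; apply/eqP; rewrite eqn_leq !le // /green_J eq_sym.
Qed.

Lemma green_R_left a b : green_R mulS a b -> exists x, a = b * x.
Proof.
move=> /eqP E; have : a \in right_ideal mulS b.
  by rewrite -E; apply/imsetP; exists 1; rewrite ?mulg1.
by case/imsetP=> x _ ->; exists x.
Qed.

Lemma green_R_sym a b : green_R mulS a b = green_R mulS b a.
Proof. exact: eq_sym. Qed.

Lemma rank_n_inv a : rank a = n -> exists b, a * b = 1 /\ b * a = 1.
Proof.
move=> /eqP; rewrite -mem_units => /POP_of_permsP[s Cs Es].
have CsV : s^-1 \in C n by rewrite groupV.
exists (POP_perm CsV); split; apply: val_inj; rewrite /= Es -permT_M.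
  by rewrite mulgV permT_1.
by rewrite mulVg permT_1.
Qed.

(** In an element of rank [n - 1] some point is missing from the domain or has
    the same image as another point. *)
Lemma rank_pred_defect a : rank a = n - 1 ->
  exists i o, POP_val a i = obind (POP_val a) o /\ o != Some i.
Proof.
move=> ra; case: (pickP (fun i => POP_val a i == None)) => [i /eqP ai|tot].
  by exists i, None.
have ta : transformation a by apply/transformationP=> i; rewrite tot.
have [i [j [_ ij aij]]] :=
  rank_pred_collapse n_gt0 (POP_orientation_preserving a) ra ta.
by exists i, (Some j); split=> //; apply: contra ij => /eqP[->].
Qed.

(** The set of right multiples of [a] contains an idempotent [elem i o] with
    [elem i o * a = a], whence the regularity of [a]. *)
Lemma rank_pred_regular a : rank a = n - 1 -> exists x, a * x * a = a.
Proof.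
move=> ra; have [i [o [ai oi]]] := rank_pred_defect ra.
pose P t := exists y : POP n, t = POP_val (a * y).
have [||| y Ey] := @elem_power n P a i o _ _ _ ra ai oi.
- by move=> _ _ [y ->] [z ->]; exists (y * (a * z)); rewrite !POP_valM !mulgA.
- by move=> _ s Cs [y ->]; exists (y * POP_perm Cs); rewrite !POP_valM !mulgA.
- by exists 1; rewrite mulg1.
by exists y; apply: val_inj; rewrite -[LHS]/(POP_val (a * y) * POP_val a) -Ey elem_mul.
Qed.

(** An element of rank [n - 1] generates all the deletions as an ideal.  For a
    transformation, deleting one of two points with the same image leaves the image
    unchanged, which reduces to the case of a properly partial map. *)
Lemma deletion_in_ideal a i : rank a = n - 1 ->
  exists x y, deletion i = x * a * y.
Proof.
move=> ra.
pose P t := exists x y, t = POP_val (x * a * y).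
have PM t v : P t -> P v -> P (t * v).
  move=> [x [y ->]] [z [w ->]]; exists x, (y * (z * a * w)).
  by rewrite !POP_valM !mulgA.
have PC t s : s \in C n -> P t -> P (t * PT_of_perm s).
  by move=> Cs [x [y ->]]; exists x, (y * POP_perm Cs); rewrite !POP_valM !mulgA.
have PCl t s : s \in C n -> P t -> P (PT_of_perm s * t).
  by move=> Cs [x [y ->]]; exists (POP_perm Cs * x), y; rewrite !POP_valM !mulgA.
have Pa : P a by exists 1, 1; rewrite mul1g mulg1.
suff [j Pj] : exists j, P (elem j None).
  have [s Cs si] := C_transitive j i.
  have : P (elem (s j) (omap s None)).
    by rewrite -elem_conj; apply: PC => //; apply: PCl; rewrite ?groupV.
  by rewrite si => -[x [y E]]; exists x, y; apply: val_inj.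
case: (pickP (fun i => POP_val a i == None)) => [j /eqP aj|tot].
  by exists j; apply: (@elem_power n P a j None PM PC Pa ra aj).
have ta : transformation a by apply/transformationP=> j; rewrite tot.
have [j [k [_ jk ajk]]] :=
  rank_pred_collapse n_gt0 (POP_orientation_preserving a) ra ta.
exists j; apply: (@elem_power n P (elem j None * POP_val a) j None PM PC) => //.
- have [x [y ->]] := Pa; exists (deletion j * x), y; by rewrite !POP_valM !mulgA.
- rewrite -ra; apply: eq_card => l; apply/imP/imP=> -[m]; rewrite ?mulE ?ffunE.
    by case: ifP => // _; exists m.
  have [->|mj] := eqVneq m j; [exists k|exists m]; rewrite mulE ffunE.
    by rewrite eq_sym (negPf jk) /= -ajk.
  by rewrite (negPf mj).
- by rewrite mulE ffunE eqxx.
Qed.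

Lemma green_J_deletion a i : rank a = n - 1 -> green_J mulS a (deletion i).
Proof.
move=> ra; have [l nl] := rank_pred_missed n_gt0 ra.
have [x [y E]] := deletion_in_ideal i ra.
have [z [t E']] := @deletion_in_ideal (deletion i) l (rank_deletion i).
apply: (green_J_intro (x := a * z) (y := t) _ E).
rewrite -!mulgA [z * _]mulgA -E'.
by apply: val_inj; rewrite /= mul_elem.
Qed.

Lemma J_class_rank_pred i :
  J_class mulS (deletion i) = [set a : POP n | rank a == n - 1].
Proof.
apply/setP=> a; rewrite !inE; apply/idP/eqP=> [/green_J_rank <-|ra].
  exact: rank_deletion.
by rewrite /green_J eq_sym; apply: green_J_deletion.
Qed.

Lemma J_class_units : J_class mulS 1 = POP_of_perms (C n).
Proof.
apply/setP=> a; rewrite mem_units inE; apply/idP/eqP=> [/green_J_rank <-|ra].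
  by have -> : POP_val (1 : POP n) = PT_of_perm 1; rewrite ?rank_permT ?permT_1.
have [b [ab ba]] := rank_n_inv ra.
by apply: (green_J_intro (x := 1) (y := b) (z := 1) (t := a)); rewrite !mul1g.
Qed.

(** A maximal subsemigroup omitting only elements of rank [n - 1] has type (M4)
    when the set of those omitted is closed under Green's relation R. *)
Lemma type_M4_intro M : maximal_subsemigroup mulS M ->
    (forall a, a \notin M -> rank a = n - 1) ->
    (exists2 a, a \in M & rank a = n - 1) ->
    (forall a b, green_R mulS a b -> a \in M -> b \in M) ->
  type_M4 mulS M.
Proof.
move=> maxM outM [a0 Ma0 ra0] RM.
exists [set a : POP n | rank a == n - 1]; split.
- split=> //; first by exists (deletion (Ordinal n2)); rewrite J_class_rank_pred.
  by apply/subsetP=> a; rewrite !inE => /outM->.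
- by move=> a; rewrite inE => /eqP/rank_pred_regular.
exists (M :&: [set a : POP n | rank a == n - 1]); split.
- by apply/set0Pn; exists a0; rewrite !inE Ma0 ra0 /=.
- exact: subsetIr.
apply/setP=> a; apply/idP/bigcupP=> [Ma|[b]].
  by exists a => //; rewrite inE /green_R.
rewrite !inE => /andP[Mb /eqP rb] Rba; rewrite (RM b a Rba Mb) /=.
have [x Ex] := green_R_left Rba.
have [y Ey] := green_R_left (etrans (green_R_sym a b) Rba).
rewrite eqn_leq {1}Ey -rb rank_mull /=.
by rewrite rb -rb Ex rank_mull.
Qed.

Lemma setB_type : type_M4 mulS setB.
Proof.
apply: type_M4_intro; first exact: setB_maximal.
- by move=> a; rewrite mem_setB negbK => /andP[_ /eqP].
- by exists (deletion (Ordinal n2)); rewrite ?deletion_in_setB ?rank_deletion.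
move=> a b Rab; rewrite !mem_setB; apply: contra => /andP[tb /eqP rb].
have [x Ex] := green_R_left Rab.
have [y Ey] := green_R_left (etrans (green_R_sym b a) Rab).
rewrite (_ : transformation a); last first.
  by rewrite Ey in tb; apply: transformation_mull tb.
by rewrite eqn_leq {1}Ex -{1}rb rank_mull /= -rb Ey rank_mull.
Qed.

Lemma setC_type : type_M4 mulS setC.
Proof.
apply: type_M4_intro; first exact: setC_maximal.
- by move=> a; rewrite mem_setC // negbK => /andP[_ /eqP].
- by exists (collapse n2); rewrite ?collapse_in_setC ?rank_collapse.
move=> a b Rab; rewrite !mem_setC //; apply: contra => /andP[tb /eqP rb].
have [x Ex] := green_R_left Rab.
have [y Ey] := green_R_left (etrans (green_R_sym b a) Rab).
rewrite (_ : ~~ transformation a); last first.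
  by apply: contra tb; rewrite Ex; apply: transformation_mull.
by rewrite eqn_leq {1}Ex -{1}rb rank_mull /= -rb Ey rank_mull.
Qed.

Lemma setA_type L : maximal L (C n) -> type_M5 mulS (setA L).
Proof.
move=> maxL; exists (POP_of_perms (C n)); split.
- split; [exact: setA_maximal|by exists 1; rewrite J_class_units|].
  by rewrite setCU setCK subsetIl.
- move=> a; rewrite mem_units => /eqP/rank_n_inv[b [ab _]].
  by exists b; rewrite ab mul1g.
(* All units are H-related to the identity, which lies in [setA L]. *)
move=> a; rewrite mem_units => /eqP/rank_n_inv[b [ab ba]].
apply/set0Pn; exists 1.
rewrite !in_setI one_in_units (mem_setA L (s := 1)) ?group1 //; last by rewrite permT_1.
rewrite inE /=; apply/andP; split; apply/eqP/setP=> c; apply/imsetP/imsetP=> -[x _ ->].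
- by exists (a * x); rewrite ?mul1g.
- by exists (b * x); rewrite // mulgA ab mul1g.
- by exists (x * a); rewrite ?mulg1.
- by exists (x * b); rewrite // -mulgA ba mulg1.
Qed.

End Types.

(** * Counting *)

Section Counting.

Variable gT : finGroupType.
Implicit Types (G L : {group gT}) (x : gT).

(** The maximal subgroups of a finite cyclic group are those of prime index, one
    for each prime divisor of the order. *)
Lemma maximal_cycle x L :
  maximal L <[x]> = (L \in [seq <[x ^+ p]>%G | p <- primes #[x]]).
Proof.
apply/idP/mapP=> [maxL|[p p_x EL]].
  have [pL _] := maxgroupP maxL; have sL := proper_sub pL.
  have i1 : 1 < #|<[x]> : L| by rewrite indexg_gt1 (proper_subn pL).
  (* With [p] a prime divisor of the index of [L], the subgroup of index [p]
     contains [L], by comparison of orders. *)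
  pose p := pdiv #|<[x]> : L|.
  have p_pr : prime p by apply: pdiv_prime.
  have px : p %| #[x] by apply: dvdn_trans (pdiv_dvd _) (dvdn_indexg _ _).
  exists p; first by rewrite mem_primes p_pr order_gt0 px.
  have op : #[x ^+ p] = #[x] %/ p by apply: orderXdiv.
  have sp : <[x ^+ p]> \subset <[x]> by rewrite cycleX.
  have sLp : L \subset <[x ^+ p]>.
    rewrite -(cardSg_cyclic (cycle_cyclic x)) //.
    rewrite [X in _ %| X]op dvdn_divRL // orderE -(Lagrange sL).
    by rewrite dvdn_pmul2l ?cardG_gt0 ?pdiv_dvd.
  have /maximal_eqP[_ /(_ <[x ^+ p]>%G sLp sp)[E|E]] :
      maximal_eq L <[x]>; first by rewrite /maximal_eq maxL orbT.
    exact/val_inj/esym.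
  have : #[x ^+ p] = #[x] by rewrite orderE E.
  rewrite op => /eqP; rewrite eqn_leq => /andP[_].
  by rewrite leqNgt ltn_Pdiv ?order_gt0 ?prime_gt1.
rewrite EL; move: p_x; rewrite mem_primes => /and3P[p_pr _ px].
apply: p_index_maximal; first exact: cycleX.
by rewrite -divgS ?cycleX // -!orderE orderXdiv // divnA // mulKn ?order_gt0.
Qed.

Lemma uniq_maximal_cycle x : uniq [seq <[x ^+ p]>%G | p <- primes #[x]].
Proof.
rewrite map_inj_in_uniq ?primes_uniq // => p q.
rewrite !mem_primes => /and3P[_ _ px] /and3P[_ _ qx] /(congr1 val) /= E.
have : #[x ^+ p] = #[x ^+ q] by rewrite !orderE E.
rewrite !orderXdiv // => /(congr1 (divn #[x])).
by rewrite !divnA // !mulKn ?order_gt0.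
Qed.

End Counting.

Section Count.
Variable n : nat.
Hypothesis n2 : 1 < n.
Implicit Types (L : {group 'S_n}) (M : {set POP n}).

Local Notation mulS := (@mul (POP n)).
Local Notation setA L := (~: POP_of_perms (C n) :|: POP_of_perms L).
Local Notation setB := (~: [set a in OP n | rank a == n - 1]).
Local Notation setC := (~: [set a in POPI n | rank a == n - 1]).

Lemma setA_inj L1 L2 : L1 \subset C n -> L2 \subset C n ->
  setA L1 = setA L2 :> {set POP n} -> L1 = L2.
Proof.
move=> L1C L2C /setP E; apply/val_inj/setP=> s /=.
have eqs : s \in C n -> (s \in L1) = (s \in L2).
  by move=> Cs; have := E (POP_perm Cs); rewrite !(@mem_setA n _ _ s).
by apply/idP/idP=> Ls; [rewrite -eqs ?(subsetP L1C)|rewrite eqs ?(subsetP L2C)].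
Qed.

Lemma units_not_sub_setA L : L \proper C n ->
  ~~ (POP_of_perms (C n) \subset setA L).
Proof.
case/properP=> _ [s Cs nL]; apply/subsetPn; exists (POP_perm Cs).
  by rewrite (POP_of_perms_inj _ (s := s)).
by rewrite (mem_setA L (s := s)).
Qed.

Lemma card_maximal_subsemigroups :
  #|[set M | maximal_subsemigroup mulS M]| = size (primes n) + 2.
Proof.
pose maxs := [seq <[rotation n ^+ p]>%G | p <- primes n].
have mem_maxs L : (L \in maxs) = maximal L (C n).
  by rewrite maximal_cycle orderE (card_C (ltnW n2)).
have uniq_maxs : uniq maxs.
  by have := uniq_maximal_cycle (rotation n); rewrite orderE (card_C (ltnW n2)).
have maxs_proper L : L \in maxs -> L \proper C n.
  by rewrite mem_maxs => /maxgroupP[].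
pose ms : seq {set POP n} := [:: setB; setC] ++
  [seq setA L : {set POP n} | L : {group 'S_n} <- maxs].
have -> : (size (primes n) + 2)%N = size ms by rewrite size_cat !size_map addnC.
have notA M : POP_of_perms (C n) \subset M ->
    M \notin [seq setA L : {set POP n} | L : {group 'S_n} <- maxs].
  move=> UM; apply/mapP=> -[L /maxs_proper pL EM].
  by have := units_not_sub_setA pL; rewrite -EM UM.
have BC : setB != setC :> {set POP n}.
  apply/eqP=> /setP/(_ (collapse n2)).
  by rewrite (collapse_in_setC n2) (negPf (collapse_notin_setB n2)).
have uniq_ms : uniq ms.
  rewrite /ms /= inE negb_or BC !notA ?(units_sub_setB n2) ?(units_sub_setC n2) //=.
  rewrite map_inj_in_uniq // => L1 L2 /maxs_proper/proper_sub s1.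
  by move=> /maxs_proper/proper_sub; apply: setA_inj.
rewrite -(card_uniqP uniq_ms); apply: eq_card => M; rewrite !inE.
apply/idP/or3P=> [/(maximal_subsemigroup_POP n2)|].
  case=> [[L [maxL ->]]|->|->]; [apply: Or33|exact: Or31|exact: Or32].
  by apply: (map_f (fun L : {group 'S_n} => setA L : {set POP n})); rewrite mem_maxs.
case=> [/eqP->|/eqP->|/mapP[L]]; first exact: setB_maximal.
  exact: setC_maximal.
by rewrite mem_maxs => maxL ->; apply: setA_maximal.
Qed.

End Count.

(** * One point *)

Lemma orientation_preserving_PT1 (a : PT 1) : orientation_preserving a.
Proof.
rewrite /orientation_preserving /cyclic_descents.
apply: leq_trans (count_size _ _) _; rewrite size_zip size_rot minnn.
by rewrite size_pmap; apply: leq_trans (count_size _ _) _; rewrite size_enum_ord.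
Qed.

Lemma semilattice_POP1 : semilattice (@mul (POP 1)).
Proof.
split=> [a b|a]; apply/val_inj/ffunP=> i; rewrite !mulE (ord1 i).
  case Ea: (POP_val a ord0) => [x|]; case Eb: (POP_val b ord0) => [y|] //=.
  - by rewrite (ord1 x) (ord1 y) Ea Eb (ord1 x) (ord1 y).
  - by rewrite (ord1 x) Eb.
  - by rewrite (ord1 y) Ea.
by case Ea: (POP_val a ord0) => [x|] //=; rewrite (ord1 x) Ea (ord1 x).
Qed.

Lemma card_POP1 : #|{: POP 1}| = 2.
Proof.
have -> : #|{: POP 1}| = #|{: PT 1}|.
  rewrite -(card_imset _ (@val_inj _ _ (POP 1))); apply: eq_card => a.
  by rewrite !inE; apply/imsetP; exists (MkPOP (orientation_preserving_PT1 a)).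
by rewrite card_ffun card_option !card_ord.
Qed.

Lemma maximal_subsemigroup_POP1 (M : {set POP 1}) :
  maximal_subsemigroup (@mul (POP 1)) M <-> exists a : POP 1, M = [set a].
Proof.
split=> [/maximal_subsemigroupP[/subsemigroupP[M0 _] MT _]|[a ->]].
  apply/cards1P; rewrite eqn_leq card_gt0 M0 andbT -ltnS -card_POP1 -cardsT.
  by apply: proper_card; rewrite properT.
apply/maximal_subsemigroupP; split.
- apply/subsemigroupP; split; first by apply/set0Pn; exists a; rewrite inE.
  by move=> b c /set1P-> /set1P->; rewrite (semilattice_POP1.2 a) inE.
- apply/eqP=> /(congr1 (fun A : {set POP 1} => #|A|)).
  by rewrite cards1 cardsT card_POP1.
move=> N _ aN; case: (eqVneq N setT) => [|NT]; [by right|left].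
apply/eqP; rewrite eq_sym eqEcard aN cards1 -ltnS -card_POP1 -cardsT.
by apply: proper_card; rewrite properT.
Qed.

Lemma card_maximal_subsemigroups_POP1 :
  #|[set M : {set POP 1} | maximal_subsemigroup (@mul (POP 1)) M]| = 2.
Proof.
rewrite -card_POP1 -(card_imset _ (@set1_inj (POP 1))); apply: eq_card => M.
rewrite inE; apply/idP/imsetP=> [/maximal_subsemigroup_POP1[a ->]|[a _ ->]].
  by exists a.
by apply/maximal_subsemigroup_POP1; exists a.
Qed.

Theorem theorem3p11 :
  (forall n : nat, 2 <= n ->
     let setA (L : {group 'S_n}) : {set POP n} :=
       ~: POP_of_perms (C n) :|: POP_of_perms L in
     let setB : {set POP n} := ~: [set a in OP n | rank a == n - 1] in
     let setC : {set POP n} := ~: [set a in POPI n | rank a == n - 1] in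
     (forall M : {set POP n},
        maximal_subsemigroup (@mul (POP n)) M <->
        [\/ exists L : {group 'S_n}, maximal L (C n) /\ M = setA L,
            M = setB | M = setC])
     /\ (forall L : {group 'S_n}, maximal L (C n) -> type_M5 (@mul (POP n)) (setA L))
     /\ type_M4 (@mul (POP n)) setB
     /\ type_M4 (@mul (POP n)) setC)
  /\ ((forall a : PT 1, orientation_preserving a)
      /\ semilattice (@mul (POP 1))
      /\ #|{: POP 1}| = 2
      /\ forall M : {set POP 1},
           maximal_subsemigroup (@mul (POP 1)) M <-> exists a : POP 1, M = [set a])
  /\ (forall n : nat, 1 <= n ->
        #|[set M : {set POP n} | maximal_subsemigroup (@mul (POP n)) M]|
          = size (primes n) + 2).
Proof.
split; last split.
- move=> n n2 setA setB setC; split; last split; last split.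
  + exact: maximal_subsemigroup_POP.
  + exact: setA_type.
  + exact: setB_type.
  + exact: setC_type.
- split; first exact: orientation_preserving_PT1.
  split; first exact: semilattice_POP1.
  split; [exact: card_POP1|exact: maximal_subsemigroup_POP1].
move=> n; rewrite leq_eqVlt => /predU1P[<-|n2]; last exact: card_maximal_subsemigroups.
exact: card_maximal_subsemigroups_POP1.
Qed.
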